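(* Let $p$ be a prime, let $a,c\in\mathbb{Q}_p$ with $ac\neq 0$ and $\sqrt{c^2-4a}\in\mathbb{Q}_p$, and let $f(x)=\frac{ax}{x^2+cx+a}$ for $x\in\mathbb{Q}_p\setminus\{\hat x_1,\hat x_2\}$, where $\hat x_{1,2}=\frac{-c\pm\sqrt{c^2-4a}}{2}$. Let $x_1=0$ and $x_2=-c$ be its fixed points, and put $\alpha=\min\{|\hat x_1|_p,|\hat x_2|_p\}$, $\beta=\max\{|\hat x_1|_p,|\hat x_2|_p\}$. Then: 1. $SI(x_1)=U_\alpha(0)$. 2. If $|c|_p<\alpha=\beta$, then $x_2$ is an indifferent fixed point of $f$ and $SI(x_2)=SI(x_1)$. 3. If $|c|_p=\alpha=\beta$ and $|a-c^2|_p=\alpha^2$, then $x_2$ is an indifferent fixed point of $f$, $SI(x_2)=U_\alpha(x_2)$ and $SI(x_2)\cap SI(x_1)=\emptyset$. 4. If $|c|_p=\alpha=\beta$ and $|a-c^2|_p<\alpha^2$, then $x_2$ is an attractive fixed point of $f$ and $A(x_2)=U_\alpha(x_2)\subset S_\alpha(0)$. 5. If $\alpha<\beta$, then $x_2\in S_\beta(0)$ is a repelling fixed point of $f$, and the inequality $|f(x)-x_2|_p>|x-x_2|_p$ holds for all $x\in U_\beta(x_2)$ with $x\neq x_2$ and $x\notin\{\hat x_1,\hat x_2\}$.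
   Context: $|\cdot|_p$ is the $p$-adic norm on $\mathbb{Q}_p$. For $s\in\mathbb{Q}_p$ and $r>0$: $U_r(s)=\{x\in\mathbb{Q}_p:|x-s|_p<r\}$ and $S_r(s)=\{x\in\mathbb{Q}_p:|x-s|_p=r\}$. For a fixed point $x_0$ of $f$ put $\lambda=f'(x_0)$; $x_0$ is attractive if $|\lambda|_p<1$, indifferent if $|\lambda|_p=1$, repelling if $|\lambda|_p>1$. The basin of attraction of $x_0$ is $A(x_0)=\{x\in\mathbb{Q}_p: f^n(x)\text{ is defined for all }n\geq 1\text{ and } f^n(x)\to x_0 \text{ as } n\to\infty\}$, where $f^n$ is the $n$-fold iterate. A sphere $S_\rho(x_0)$ is invariant for $f$ if for every $x\in S_\rho(x_0)$ all iterates $f^n(x)$, $n\ge 1$, are defined and belong to $S_\rho(x_0)$. The ball $U_r(x_0)$ is a Siegel disk if each sphere $S_\rho(x_0)$ with $\rho<r$ is invariant for $f$. $SI(x_0)$ denotes the union of all Siegel disks with center $x_0$ (the maximum Siegel disk). *)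

(* Defs.v *)
From HB Require Import structures.
From mathcomp Require Import all_boot all_order all_algebra.
From mathcomp Require Import generic_quotient ring_quotient.
From mathcomp Require Import boolp classical_sets functions reals topology.
From mathcomp Require Import normedtype sequences.
From mathcomp Require Import ring.

Set Implicit Arguments.
Unset Strict Implicit.
Unset Printing Implicit Defensive.

Import Order.TTheory GRing.Theory Num.Theory.
Import numFieldNormedType.Exports.

Local Open Scope classical_set_scope.
Local Open Scope ring_scope.

(* The field Q_p is the completion of rat for its p-adic absolute value:
   Cauchy sequences of rationals modulo the ideal of null sequences. *)

Section RatAbs.
Variable p : nat.

Definition rat_val (x : rat) : int :=
  (logn p `|numq x|)%:Z - (logn p `|denq x|)%:Z.

Definition rat_abs (x : rat) : rat :=
  if x == 0 then 0 else p%:R ^ (- rat_val x).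

Hypothesis p_pr : prime p.

Let p_gt0 : 0 < p%:R :> rat.
Proof. by rewrite ltr0n prime_gt0. Qed.

Let p_gt1 : 1 < p%:R :> rat.
Proof. by rewrite ltr1n prime_gt1. Qed.

Lemma rat_abs0 : rat_abs 0 = 0.
Proof. by rewrite /rat_abs eqxx. Qed.

Lemma rat_abs_gt0 x : x != 0 -> 0 < rat_abs x.
Proof. by move=> x0; rewrite /rat_abs (negPf x0) exprz_gt0. Qed.

Lemma rat_abs_ge0 x : 0 <= rat_abs x.
Proof.
by have [->|/rat_abs_gt0/ltW//] := eqVneq x 0; rewrite rat_abs0.
Qed.

Lemma rat_abs_eq0 x : (rat_abs x == 0) = (x == 0).
Proof.
by have [->|/rat_abs_gt0/gt_eqF//] := eqVneq x 0; rewrite rat_abs0 eqxx.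
Qed.

Lemma rat_val_frac (a b : int) : a != 0 -> b != 0 ->
  rat_val (a%:~R / b%:~R) = (logn p `|a|)%:Z - (logn p `|b|)%:Z.
Proof.
move=> a0 b0; set x : rat := _ / _.
have bQ : b%:~R != 0 :> rat by rewrite intr_eq0.
have x0 : x != 0 by rewrite mulf_neq0 ?invr_eq0 ?intr_eq0.
have E : (numq x * b)%R = (a * denq x)%R.
  apply/eqP; rewrite -(eqr_int rat) !intrM.
  have := divq_num_den x; move/(canRL (mulfVK _)) => ->; last first.
    by rewrite intr_eq0 denq_neq0.
  by rewrite /x mulrAC divfK.
have E' : (`|numq x| * `|b|)%N = (`|a| * `|denq x|)%N by rewrite -!abszM E.
have /(congr1 Posz) : (logn p `|numq x| + logn p `|b|)%N
    = (logn p `|a| + logn p `|denq x|)%N.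
  by rewrite -!lognM ?absz_gt0 ?numq_eq0 ?denq_neq0 // E'.
rewrite !PoszD /rat_val => E2; apply/eqP.
by rewrite subr_eq addrAC eq_sym subr_eq eq_sym; apply/eqP.
Qed.

Lemma rat_absM x y : rat_abs (x * y) = rat_abs x * rat_abs y.
Proof.
have [->|x0] := eqVneq x 0; first by rewrite mul0r rat_abs0 mul0r.
have [->|y0] := eqVneq y 0; first by rewrite mulr0 rat_abs0 mulr0.
rewrite /rat_abs mulf_eq0 (negPf x0) (negPf y0) /=.
rewrite -expfzDr ?gt_eqF //; congr (_ ^ _).
rewrite -{1}(divq_num_den x) -{1}(divq_num_den y) mulf_div -!intrM.
rewrite rat_val_frac ?mulf_neq0 ?numq_eq0 ?denq_neq0 //.
rewrite !abszM !lognM ?absz_gt0 ?numq_eq0 ?denq_neq0 // !PoszD /rat_val.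
by rewrite -[RHS]opprD; congr (- _); rewrite [RHS]addrACA -opprD.
Qed.

Lemma rat_abs1 : rat_abs 1 = 1.
Proof.
have n0 : rat_abs 1 != 0 by rewrite rat_abs_eq0 oner_eq0.
by apply: (mulfI n0); rewrite -rat_absM !mulr1.
Qed.

Lemma rat_absV x : rat_abs x^-1 = (rat_abs x)^-1.
Proof.
have [->|x0] := eqVneq x 0; first by rewrite !(invr0, rat_abs0).
have n0 : rat_abs x != 0 by rewrite rat_abs_eq0.
by apply: (mulfI n0); rewrite -rat_absM !divff ?rat_abs1.
Qed.

Lemma rat_absN x : rat_abs (- x) = rat_abs x.
Proof.
suff : rat_abs (-1) = 1 by move=> E; rewrite -mulN1r rat_absM E mul1r.
apply/eqP; rewrite -sqrp_eq1 ?rat_abs_ge0 //.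
by rewrite expr2 -rat_absM mulrNN !mulr1 rat_abs1.
Qed.

Lemma rat_absB x y : rat_abs (x - y) = rat_abs (y - x).
Proof. by rewrite -rat_absN opprB. Qed.

Lemma rat_absD x y : rat_abs (x + y) <= Num.max (rat_abs x) (rat_abs y).
Proof.
have [->|x0] := eqVneq x 0; first by rewrite add0r le_max lexx orbT.
have [->|y0] := eqVneq y 0; first by rewrite addr0 le_max lexx.
have [->|xy0] := eqVneq (x + y) 0.
  by rewrite rat_abs0 le_max !rat_abs_ge0.
pose d := denq x * denq y.
pose a := numq x * denq y; pose b := numq y * denq x.
have dQ : d%:~R != 0 :> rat by rewrite intr_eq0 mulf_neq0 ?denq_neq0.
have d0 : d != 0 by rewrite mulf_neq0 ?denq_neq0.
have Ex : x = a%:~R / d%:~R.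
  rewrite /a /d !intrM -mulf_div divff ?mulr1 ?divq_num_den //.
  by rewrite intr_eq0 denq_neq0.
have Ey : y = b%:~R / d%:~R.
  rewrite /b /d [denq x * _]mulrC !intrM -mulf_div divff ?mulr1 ?divq_num_den //.
  by rewrite intr_eq0 denq_neq0.
have Exy : x + y = (a + b)%:~R / d%:~R by rewrite Ex Ey -mulrDl -intrD.
have a0 : a != 0 by rewrite mulf_neq0 ?numq_eq0 ?denq_neq0.
have b0 : b != 0 by rewrite mulf_neq0 ?numq_eq0 ?denq_neq0.
have ab0 : a + b != 0.
  by apply: contraNneq xy0 => E; rewrite Exy E mul0r.
rewrite /rat_abs (negPf x0) (negPf y0) (negPf xy0) Exy Ex Ey.
rewrite !rat_val_frac // le_max !ler_eXz2l // !lerN2 !lerD2r !lez_nat.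
set l := minn (logn p `|a|) (logn p `|b|).
have da : (p ^ l %| `|a|)%N.
  by apply: dvdn_trans (pfactor_dvdnn p `|a|); apply: dvdn_exp2l; exact: geq_minl.
have db : (p ^ l %| `|b|)%N.
  by apply: dvdn_trans (pfactor_dvdnn p `|b|); apply: dvdn_exp2l; exact: geq_minr.
have dab : (p ^ l %| `|(a + b)%R|)%N.
  have Ha : a \in dvdz (p ^ l)%N by [].
  have Hb : b \in dvdz (p ^ l)%N by [].
  exact: (rpredD Ha Hb).
have : (l <= logn p `|(a + b)%R|)%N by rewrite -pfactor_dvdn // absz_gt0.
by rewrite geq_min.
Qed.

End RatAbs.
Lemma rat_abs_close p : prime p -> forall x y,
  rat_abs p (x - y) < rat_abs p y -> rat_abs p x = rat_abs p y.
Proof.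
move=> p_pr x y xy; apply/eqP; rewrite eq_le; apply/andP; split.
  have := rat_absD p_pr (x - y) y; rewrite subrK => /le_trans; apply.
  by rewrite ge_max (ltW xy) lexx.
have := rat_absD p_pr (y - x) x; rewrite subrK rat_absB // le_max.
by rewrite leNgt xy.
Qed.

Section CauchySequences.
Variables (p : nat) (p_pr : prime p).
Implicit Types u v : nat -> rat.

Definition cauchy_pred (_ : prime p) : {pred nat -> rat} := fun u =>
  `[< forall e : rat, 0 < e -> exists N, forall m n,
        (N <= m)%N -> (N <= n)%N -> rat_abs p (u m - u n) < e >].

Local Notation cauchy := (cauchy_pred p_pr).

Lemma cauchyP u : reflect (forall e : rat, 0 < e -> exists N, forall m n,
  (N <= m)%N -> (N <= n)%N -> rat_abs p (u m - u n) < e) (u \in cauchy).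
Proof. exact: asboolP. Qed.

Lemma cauchy_bounded u : u \in cauchy ->
  exists2 M : rat, 0 < M & forall n, rat_abs p (u n) <= M.
Proof.
move/cauchyP/(_ 1 ltr01) => [N hN].
pose S := \sum_(i < N.+1) rat_abs p (u i).
have S0 : 0 <= S by apply: sumr_ge0 => i _; exact: rat_abs_ge0.
have hS i : (i <= N)%N -> rat_abs p (u i) <= S.
  move=> iN; have iN1 : (i < N.+1)%N by [].
  rewrite /S (bigD1 (Ordinal iN1)) //= lerDl.
  by apply: sumr_ge0 => j _; exact: rat_abs_ge0.
exists (1 + S); first by rewrite ltr_pwDl.
move=> n; have [nN|/ltnW Nn] := leqP n N.
  by rewrite (le_trans (hS _ nN)) // lerDr.
have := rat_absD p_pr (u n - u N) (u N); rewrite subrK => /le_trans; apply.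
rewrite ge_max (le_trans (ltW (hN n N Nn (leqnn _)))) ?lerDl //=.
by rewrite (le_trans (hS _ (leqnn _))) // lerDr.
Qed.

Lemma cauchy_subring_closed : subring_closed cauchy.
Proof.
split.
- apply/cauchyP => e e0; exists 0%N => m n _ _.
  by rewrite [X in rat_abs _ X](_ : _ = 0) ?rat_abs0 // subrr.
- move=> u v /cauchyP hu /cauchyP hv; apply/cauchyP => e e0.
  have [N hN] := hu e e0; have [N' hN'] := hv e e0.
  exists (maxn N N') => m n; rewrite !geq_max => /andP[m1 m2] /andP[n1 n2].
  have -> : (u - v) m - (u - v) n = (u m - u n) + (v n - v m).
    by rewrite -[(u - v) m]/(u m - v m) -[(u - v) n]/(u n - v n); ring.
  by rewrite (le_lt_trans (rat_absD _ _ _)) // gt_max hN // hN'.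
- move=> u v uc vc; apply/cauchyP => e e0.
  have [M M0 hM] := cauchy_bounded uc; have [M' M'0 hM'] := cauchy_bounded vc.
  have [N hN] := cauchyP _ uc _ (divr_gt0 e0 M'0).
  have [N' hN'] := cauchyP _ vc _ (divr_gt0 e0 M0).
  exists (maxn N N') => m n; rewrite !geq_max => /andP[m1 m2] /andP[n1 n2].
  have -> : (u * v) m - (u * v) n = (u m - u n) * v m + u n * (v m - v n).
    by rewrite mulrBl mulrBr addrA subrK.
  rewrite (le_lt_trans (rat_absD _ _ _)) // !rat_absM // gt_max.
  apply/andP; split.
    rewrite (le_lt_trans (_ : _ <= rat_abs p (u m - u n) * M')) //.
      by rewrite ler_wpM2l ?rat_abs_ge0.
    by rewrite -ltr_pdivlMr // hN.
  rewrite (le_lt_trans (_ : _ <= M * rat_abs p (v m - v n))) //.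
    by rewrite ler_wpM2r ?rat_abs_ge0.
  by rewrite mulrC -ltr_pdivlMr // hN'.
Qed.

HB.instance Definition _ :=
  GRing.isSubringClosed.Build (nat -> rat) cauchy cauchy_subring_closed.

Record cseq := CSeq { cseq_val :> nat -> rat; _ : cseq_val \in cauchy }.
HB.instance Definition _ := [isSub for cseq_val].
HB.instance Definition _ := [Choice of cseq by <:].
HB.instance Definition _ := [SubChoice_isSubComNzRing of cseq by <:].

Definition null_pred : {pred cseq} := fun u : cseq =>
  `[< forall e : rat, 0 < e -> exists N, forall n, (N <= n)%N ->
        rat_abs p (u n) < e >].

Lemma nullP (u : cseq) : reflect (forall e : rat, 0 < e -> exists N, forall n,
  (N <= n)%N -> rat_abs p (u n) < e) (u \in null_pred).
Proof. exact: asboolP. Qed.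

Lemma null_idealr_closed : idealr_closed null_pred.
Proof.
split.
- by apply/nullP => e e0; exists 0%N => n _; rewrite rat_abs0.
- apply/negP => /nullP/(_ 1 ltr01)[N /(_ N (leqnn _))].
  by rewrite /= rat_abs1 // ltxx.
- move=> a u v /nullP hu /nullP hv; apply/nullP => e e0.
  have [M M0 hM] := cauchy_bounded (valP a).
  have [N hN] := hu _ (divr_gt0 e0 M0); have [N' hN'] := hv e e0.
  exists (maxn N N') => n; rewrite !geq_max => /andP[n1 n2].
  rewrite [X in rat_abs _ X](_ : _ = a n * u n + v n) //.
  rewrite (le_lt_trans (rat_absD _ _ _)) // gt_max hN' // andbT rat_absM //.
  rewrite (le_lt_trans (_ : _ <= M * rat_abs p (u n))) //.
    by rewrite ler_wpM2r ?rat_abs_ge0.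
  by rewrite mulrC -ltr_pdivlMr // hN.
Qed.

HB.instance Definition _ := isIdealr.Build cseq null_pred null_idealr_closed.

Lemma cauchy_abs_stationary (u : cseq) : u \notin null_pred ->
  exists2 v : rat, 0 < v & exists N, forall n, (N <= n)%N -> rat_abs p (u n) = v.
Proof.
move=> /nullP/existsNP[e /not_implyP[e0 /forallNP hu]].
have [N hN] := cauchyP _ (valP u) _ e0.
have /existsNP[n0 /not_implyP[Nn0 /negP]] := hu N; rewrite -leNgt => en0.
exists (rat_abs p (u n0)); first exact: lt_le_trans en0.
exists N => n Nn; apply: rat_abs_close => //.
by rewrite (lt_le_trans _ en0) // hN.
Qed.

Lemma cauchy_inv (u : cseq) : u \notin null_pred ->
  (fun n => (u n)^-1) \in cauchy.
Proof.
move=> /cauchy_abs_stationary[v v0 [N hN]]; apply/cauchyP => e e0.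
have [N' hN'] := cauchyP _ (valP u) _ (mulr_gt0 (mulr_gt0 v0 v0) e0).
exists (maxn N N') => m n; rewrite !geq_max => /andP[m1 m2] /andP[n1 n2].
have nz k : (N <= k)%N -> u k != 0.
  by move=> /hN E; rewrite -(rat_abs_eq0 p_pr) E gt_eqF.
have -> : (u m)^-1 - (u n)^-1 = (u n - u m) / (u m * u n).
  rewrite mulrBl invfM mulrA -[u n / u m]mulrC -mulrA divff ?nz // mulr1.
  by rewrite mulrA divff ?nz // mul1r.
rewrite rat_absM // rat_absV // rat_absM // !hN // ltr_pdivrMr ?mulr_gt0 //.
by rewrite mulrC; apply: hN'.
Qed.

End CauchySequences.

Local Open Scope quotient_scope.

Section Padic.
Variables (p : nat) (p_pr : prime p).

Definition Qp : Type := {ideal_quot (@null_pred p p_pr)}.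

HB.instance Definition _ := GRing.ComNzRing.on Qp.

Definition Qp_class (u : cseq p_pr) : Qp := \pi_{ideal_quot _} u.
Definition Qp_repr (x : Qp) : cseq p_pr :=
  @repr _ {ideal_quot (@null_pred p p_pr)} x.

Lemma Qp_reprK : cancel Qp_repr Qp_class.
Proof. exact: (@reprK _ {ideal_quot (@null_pred p p_pr)}). Qed.

Lemma Qp_class_eq u v : (Qp_class u == Qp_class v) = (u - v \in @null_pred p p_pr).
Proof. by rewrite Quotient.idealrBE. Qed.

Lemma Qp_class0 : Qp_class 0 = 0.
Proof. exact: (rmorph0 \pi_{ideal_quot (@null_pred p p_pr)}). Qed.
Lemma Qp_class1 : Qp_class 1 = 1.
Proof. exact: (rmorph1 \pi_{ideal_quot (@null_pred p p_pr)}). Qed.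
Lemma Qp_classD u v : Qp_class (u + v) = Qp_class u + Qp_class v.
Proof. exact: (rmorphD \pi_{ideal_quot (@null_pred p p_pr)}). Qed.
Lemma Qp_classB u v : Qp_class (u - v) = Qp_class u - Qp_class v.
Proof. exact: (rmorphB \pi_{ideal_quot (@null_pred p p_pr)}). Qed.
Lemma Qp_classM u v : Qp_class (u * v) = Qp_class u * Qp_class v.
Proof. exact: (rmorphM \pi_{ideal_quot (@null_pred p p_pr)}). Qed.

Lemma Qp_class_eq0 u : (Qp_class u == 0) = (u \in @null_pred p p_pr).
Proof. by rewrite -Qp_class0 Qp_class_eq subr0. Qed.

(* The fallback value 0 of [insubd] is only reached for null sequences. *)
Definition cseq_inv (u : cseq p_pr) : cseq p_pr :=
  insubd 0 (fun n => (u n)^-1).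

Definition Qp_inv (x : Qp) : Qp :=
  if x == 0 then 0
  else Qp_class (cseq_inv (Qp_repr x)).

Lemma Qp_mulVx (x : Qp) : x != 0 -> Qp_inv x * x = 1.
Proof.
move=> x0; rewrite /Qp_inv (negPf x0) -[X in _ * X](Qp_reprK x).
have un : Qp_repr x \notin @null_pred p p_pr by rewrite -Qp_class_eq0 Qp_reprK.
rewrite -Qp_classM -Qp_class1; apply/eqP; rewrite Qp_class_eq.
apply/nullP => e e0; have [v v0 [N hN]] := cauchy_abs_stationary un.
exists N => n /hN E.
rewrite [X in rat_abs _ X](_ : _ = 0) ?rat_abs0 //.
rewrite [LHS](_ : _ = cseq_inv (Qp_repr x) n * Qp_repr x n - 1) //.
rewrite /cseq_inv -[cseq_val _]/(val _) insubdK ?cauchy_inv //.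
rewrite mulVf ?subrr //.
by rewrite -(rat_abs_eq0 p_pr) E gt_eqF.
Qed.

Lemma Qp_inv0 : Qp_inv 0 = 0.
Proof. by rewrite /Qp_inv eqxx. Qed.

HB.instance Definition _ :=
  GRing.ComNzRing_isField.Build Qp Qp_mulVx Qp_inv0.

Fact Qp_class_rat_subproof (q : rat) : (fun=> q) \in cauchy_pred p_pr.
Proof.
by apply/cauchyP => e e0; exists 0%N => m n _ _; rewrite subrr rat_abs0.
Qed.

Definition Qp_of_rat (q : rat) : Qp := Qp_class (CSeq (Qp_class_rat_subproof q)).

(* The absolute values of the terms of a non-null Cauchy sequence are
   eventually constant; those of a null sequence tend to 0. *)
Definition Qp_ratabs (x : Qp) : rat :=
  if x == 0 then 0
  else xget 0 [set v | exists N, forall n, (N <= n)%N ->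
                         rat_abs p (Qp_repr x n) = v].

Lemma Qp_ratabsP (u : cseq p_pr) : u \notin @null_pred p p_pr ->
  exists N, forall n, (N <= n)%N -> rat_abs p (u n) = Qp_ratabs (Qp_class u).
Proof.
move=> un; rewrite /Qp_ratabs Qp_class_eq0 (negPf un).
set w := Qp_repr _.
have wn : w \notin @null_pred p p_pr by rewrite -Qp_class_eq0 Qp_reprK Qp_class_eq0.
have [v v0 [N hN]] := cauchy_abs_stationary wn.
have [N' /= hN'] : [set v | exists N, forall n, (N <= n)%N ->
    rat_abs p (w n) = v] (xget 0 [set v | exists N, forall n, (N <= n)%N ->
    rat_abs p (w n) = v]).
  by apply: (@xgetI _ _ _ v); exists N.
have /nullP/(_ v v0)[N'' hN''] : u - w \in @null_pred p p_pr.
  by rewrite -Qp_class_eq Qp_reprK.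
exists (maxn N (maxn N' N'')) => n; rewrite !geq_max => /and3P[n1 n2 n3].
rewrite -(hN' n) //; apply: rat_abs_close => //.
by rewrite (hN n) //; exact: hN''.
Qed.

Lemma Qp_ratabsE (x : Qp) : x != 0 ->
  exists N, forall n, (N <= n)%N -> rat_abs p (Qp_repr x n) = Qp_ratabs x.
Proof.
move=> x0; rewrite -[in Qp_ratabs x](Qp_reprK x); apply: Qp_ratabsP.
by rewrite -Qp_class_eq0 Qp_reprK.
Qed.

Lemma Qp_ratabs0 : Qp_ratabs 0 = 0.
Proof. by rewrite /Qp_ratabs eqxx. Qed.

Lemma Qp_ratabs_gt0 x : x != 0 -> 0 < Qp_ratabs x.
Proof.
move=> x0; have un : Qp_repr x \notin @null_pred p p_pr.
  by rewrite -Qp_class_eq0 Qp_reprK.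
have [v v0 [N hN]] := cauchy_abs_stationary un.
have [N' hN'] := Qp_ratabsE x0.
by rewrite -(hN' (maxn N N')) ?leq_maxr // hN ?leq_maxl.
Qed.

Lemma Qp_ratabs_ge0 x : 0 <= Qp_ratabs x.
Proof. by have [->|/Qp_ratabs_gt0/ltW] := eqVneq x 0; rewrite ?Qp_ratabs0. Qed.

Lemma Qp_ratabs_eq0 x : (Qp_ratabs x == 0) = (x == 0).
Proof.
by have [->|/Qp_ratabs_gt0/gt_eqF] := eqVneq x 0; rewrite ?Qp_ratabs0 ?eqxx.
Qed.

Lemma Qp_ratabsM x y : Qp_ratabs (x * y) = Qp_ratabs x * Qp_ratabs y.
Proof.
have [->|x0] := eqVneq x 0; first by rewrite mul0r Qp_ratabs0 mul0r.
have [->|y0] := eqVneq y 0; first by rewrite mulr0 Qp_ratabs0 mulr0.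
have [N hN] := Qp_ratabsE x0; have [N' hN'] := Qp_ratabsE y0.
have : Qp_repr x * Qp_repr y \notin @null_pred p p_pr.
  by rewrite -Qp_class_eq0 Qp_classM !Qp_reprK mulf_neq0.
move=> /Qp_ratabsP[N'']; rewrite Qp_classM !Qp_reprK => hN''.
pose n := maxn N (maxn N' N'').
have /and3P[n1 n2 n3] : [&& N <= n, N' <= n & N'' <= n]%N.
  by rewrite -!geq_max.
by rewrite -(hN n) // -(hN' n) // -(hN'' n) // -rat_absM.
Qed.

Lemma Qp_ratabsD x y :
  Qp_ratabs (x + y) <= Num.max (Qp_ratabs x) (Qp_ratabs y).
Proof.
have [->|x0] := eqVneq x 0; first by rewrite add0r le_max lexx orbT.
have [->|y0] := eqVneq y 0; first by rewrite addr0 le_max lexx.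
have [->|xy0] := eqVneq (x + y) 0.
  by rewrite Qp_ratabs0 le_max !Qp_ratabs_ge0.
have [N hN] := Qp_ratabsE x0; have [N' hN'] := Qp_ratabsE y0.
have : Qp_repr x + Qp_repr y \notin @null_pred p p_pr.
  by rewrite -Qp_class_eq0 Qp_classD !Qp_reprK.
move=> /Qp_ratabsP[N'']; rewrite Qp_classD !Qp_reprK => hN''.
pose n := maxn N (maxn N' N'').
have /and3P[n1 n2 n3] : [&& N <= n, N' <= n & N'' <= n]%N.
  by rewrite -!geq_max.
by rewrite -(hN n) // -(hN' n) // -(hN'' n) //; exact: rat_absD.
Qed.

Lemma Qp_ratabs_rat q : Qp_ratabs (Qp_of_rat q) = rat_abs p q.
Proof.
have [q0|] := boolP (CSeq (Qp_class_rat_subproof q) \in @null_pred p p_pr).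
  have /eqP E : Qp_of_rat q == 0 by rewrite Qp_class_eq0.
  rewrite E Qp_ratabs0; apply/eqP; rewrite eq_le rat_abs_ge0 //=.
  rewrite leNgt; apply/negP => /(nullP _ q0)[N /(_ N (leqnn _)) /=].
  by rewrite ltxx.
by move=> /Qp_ratabsP[N /(_ N (leqnn _))].
Qed.

Lemma Qp_of_rat_is_zmod_morphism : zmod_morphism Qp_of_rat.
Proof.
by move=> a b; rewrite /Qp_of_rat -Qp_classB; congr Qp_class; exact: val_inj.
Qed.

Lemma Qp_of_rat_is_monoid_morphism : monoid_morphism Qp_of_rat.
Proof.
split; first by rewrite -Qp_class1; congr Qp_class; exact: val_inj.
by move=> a b; rewrite /Qp_of_rat -Qp_classM; congr Qp_class; exact: val_inj.
Qed.

HB.instance Definition _ :=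
  GRing.isZmodMorphism.Build rat Qp Qp_of_rat Qp_of_rat_is_zmod_morphism.
HB.instance Definition _ :=
  GRing.isMonoidMorphism.Build rat Qp Qp_of_rat Qp_of_rat_is_monoid_morphism.

Lemma Qp_of_rat_ratr q : Qp_of_rat q = ratr q.
Proof. exact: (fmorph_eq_rat Qp_of_rat). Qed.

Lemma Qp_rat_dense (x : Qp) (e : rat) : 0 < e ->
  exists q : rat, Qp_ratabs (x - ratr q) < e.
Proof.
move=> e0; have [N hN] := cauchyP _ _ (valP (Qp_repr x)) _ e0.
exists (Qp_repr x N); rewrite -Qp_of_rat_ratr.
set y := x - _; have [->|y0] := eqVneq y 0; first by rewrite Qp_ratabs0.
pose u := Qp_repr x - CSeq (Qp_class_rat_subproof (Qp_repr x N)).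
have uy : Qp_class u = y by rewrite Qp_classB Qp_reprK.
have /Qp_ratabsP[N'] : u \notin @null_pred p p_pr by rewrite -Qp_class_eq0 uy.
rewrite uy => /(_ (maxn N N') (leq_maxr _ _)) <-.
exact: hN (leq_maxl _ _) (leqnn _).
Qed.

Lemma Qp_ratabsN x : Qp_ratabs (- x) = Qp_ratabs x.
Proof.
suff : Qp_ratabs (-1) = 1 by move=> E; rewrite -mulN1r Qp_ratabsM E mul1r.
apply/eqP; rewrite -sqrp_eq1 ?Qp_ratabs_ge0 //.
rewrite expr2 -Qp_ratabsM mulrNN mulr1.
have n0 : Qp_ratabs 1 != 0 by rewrite Qp_ratabs_eq0 oner_eq0.
by apply/eqP/(mulfI n0); rewrite -Qp_ratabsM !mulr1.
Qed.

Lemma Qp_complete (x : nat -> Qp) :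
  (forall e : rat, 0 < e -> exists N, forall m n, (N <= m)%N -> (N <= n)%N ->
     Qp_ratabs (x m - x n) < e) ->
  exists l : Qp, forall e : rat, 0 < e -> exists N, forall n, (N <= n)%N ->
     Qp_ratabs (x n - l) < e.
Proof.
move=> xC.
have dense n : exists q : rat, Qp_ratabs (x n - ratr q) < n.+1%:R^-1.
  by apply: Qp_rat_dense; rewrite invr_gt0 ltr0n.
pose q n := projT1 (cid (dense n)).
have hq n : Qp_ratabs (x n - ratr (q n)) < n.+1%:R^-1 by rewrite /q; case: cid.
have small e : 0 < e -> exists N, forall n, (N <= n)%N -> n.+1%:R^-1 < e :> rat.
  move=> e0; exists (Num.truncn e^-1) => n Nn.
  rewrite invf_plt ?posrE ?ltr0n // (lt_le_trans (truncnS_gt _)) //.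
  by rewrite ler_nat.
have qC : q \in cauchy_pred p_pr.
  apply/cauchyP => e e0; have [N hN] := xC e e0; have [N' hN'] := small e e0.
  exists (maxn N N') => m n; rewrite !geq_max => /andP[m1 m2] /andP[n1 n2].
  rewrite -Qp_ratabs_rat rmorphB /= !Qp_of_rat_ratr.
  have -> : ratr (q m) - ratr (q n) =
      (x m - x n) + (- (x m - ratr (q m)) + (x n - ratr (q n))) :> Qp by ring.
  rewrite (le_lt_trans (Qp_ratabsD _ _)) // gt_max hN //=.
  rewrite (le_lt_trans (Qp_ratabsD _ _)) // gt_max Qp_ratabsN.
  by rewrite !(lt_trans (hq _)) // hN'.
exists (Qp_class (CSeq qC)) => e e0.
have [N hN] := cauchyP _ _ qC _ e0; have [N' hN'] := small e e0.
exists (maxn N N') => n; rewrite !geq_max => /andP[n1 n2].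
rewrite -(subrK (ratr (q n)) (x n)) -addrA.
rewrite (le_lt_trans (Qp_ratabsD _ _)) // gt_max.
rewrite (lt_trans (hq _)) ?hN' //= -Qp_of_rat_ratr -Qp_classB.
set u := _ - _; have [un|] := boolP (u \in @null_pred p p_pr).
  have /eqP -> : Qp_class u == 0 by rewrite Qp_class_eq0.
  by rewrite Qp_ratabs0.
move=> /Qp_ratabsP[M /(_ (maxn N M) (leq_maxr _ _)) <-].
by apply: hN => //; exact: leq_maxl.
Qed.

End Padic.

Section Dynamics.
Variables (R : realType) (p : nat) (p_pr : prime p).
Local Notation K := (Qp p_pr).
Implicit Types (x : K) (r : R) (g : K -> option K).

Definition Qp_norm x : R := ratr (Qp_ratabs x).

Definition Qp_ball x0 r : set K := [set x | Qp_norm (x - x0) < r].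
Definition Qp_sphere x0 r : set K := [set x | Qp_norm (x - x0) = r].

(* Maps are partial: [g x = None] means that g is not defined at x, and
   [piter g n x = None] that the n-th iterate is not defined at x. *)
Definition piter g n x : option K := iter n (obind g) (Some x).

Definition fixed_point g x0 := g x0 = Some x0.

Definition is_pderive g x0 (l : K) :=
  exists2 y0, g x0 = Some y0 &
  forall e : R, 0 < e -> exists2 d : R, 0 < d &
    forall x, x != x0 -> Qp_norm (x - x0) < d ->
      exists2 y, g x = Some y & Qp_norm ((y - y0) / (x - x0) - l) < e.

Definition attractive g x0 :=
  fixed_point g x0 /\ exists2 l, is_pderive g x0 l & Qp_norm l < 1.
Definition indifferent g x0 :=
  fixed_point g x0 /\ exists2 l, is_pderive g x0 l & Qp_norm l = 1.
Definition repelling g x0 :=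
  fixed_point g x0 /\ exists2 l, is_pderive g x0 l & 1 < Qp_norm l.

Definition basin g x0 : set K := [set x | exists u : nat -> K,
  (forall n, (1 <= n)%N -> piter g n x = Some (u n)) /\
  Qp_norm (u n - x0) @[n --> \oo] --> (0 : R)].

Definition invariant_sphere g x0 r := forall x, Qp_sphere x0 r x ->
  forall n, (1 <= n)%N -> exists2 y, piter g n x = Some y & Qp_sphere x0 r y.

Definition Siegel_disk g x0 r :=
  forall rho : R, 0 < rho -> rho < r -> invariant_sphere g x0 rho.

Definition SI g x0 : set K :=
  \bigcup_(r in [set r | 0 < r /\ Siegel_disk g x0 r]) Qp_ball x0 r.

Lemma Qp_norm_ge0 x : 0 <= Qp_norm x.
Proof. by rewrite ler0q Qp_ratabs_ge0. Qed.

Lemma Qp_norm_eq0 x : (Qp_norm x == 0) = (x == 0).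
Proof. by rewrite fmorph_eq0 Qp_ratabs_eq0. Qed.

Lemma Qp_normM x y : Qp_norm (x * y) = Qp_norm x * Qp_norm y.
Proof. by rewrite /Qp_norm Qp_ratabsM rmorphM. Qed.

Lemma Qp_normD x y : Qp_norm (x + y) <= Num.max (Qp_norm x) (Qp_norm y).
Proof. by rewrite /Qp_norm -maxr_rat ler_rat Qp_ratabsD. Qed.

Lemma Qp_norm_rat (q : rat) : Qp_norm (ratr q) = ratr (rat_abs p q).
Proof. by rewrite /Qp_norm -Qp_of_rat_ratr Qp_ratabs_rat. Qed.

End Dynamics.

(* xh1 and xh2 stand for the poles, i.e. the roots of x^2 + c x + a. *)
Definition ratmap p (p_pr : prime p) (a c xh1 xh2 x : Qp p_pr) :
    option (Qp p_pr) :=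
  if (x == xh1) || (x == xh2) then None
  else Some (a * x / (x ^+ 2 + c * x + a)).

Lemma ratmap_fixed_points p (p_pr : prime p) (a c xh1 xh2 : Qp p_pr) :
    a != 0 -> xh1 + xh2 = - c -> xh1 * xh2 = a -> forall x,
  fixed_point (ratmap a c xh1 xh2) x <-> x = 0 \/ x = - c.
Proof.
move=> a0 Ec Ea x; rewrite /fixed_point /ratmap.
have Eq : x ^+ 2 + c * x + a = (x - xh1) * (x - xh2).
  by rewrite -Ea -[c]opprK -Ec; ring.
have /norP[h1 h2] : ~~ ((xh1 == 0) || (xh2 == 0)) by rewrite -mulf_eq0 Ea.
have [/orP xx|/norP[n1 n2]] := boolP ((x == xh1) || (x == xh2)).
  split=> // -[E|E]; case: xx => /eqP xx.
  - by rewrite -xx E eqxx in h1.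
  - by rewrite -xx E eqxx in h2.
  - by move: h2; rewrite -(addKr xh1 xh2) Ec -xx E addNr eqxx.
  - by move: h1; rewrite -(addrK xh2 xh1) Ec -xx E subrr eqxx.
have q0 : x ^+ 2 + c * x + a != 0 by rewrite Eq mulf_neq0 ?subr_eq0.
split=> [[E]|E].
  have {}E : a * x = x * (x ^+ 2 + c * x + a) by rewrite -{2}E divfK.
  have /eqP : x * (x * (x + c)) = 0.
    transitivity (x * (x ^+ 2 + c * x + a) - a * x); first by ring.
    by rewrite -E subrr.
  by rewrite !mulf_eq0 orbA orbb addr_eq0 => /orP[]/eqP; [left|right].
congr Some; apply: (mulIf q0); rewrite divfK //.
by case: E => ->; ring.
Qed.

(* Main.v *)
Require Import Defs.
From mathcomp Require Import all_boot all_order all_algebra.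
From mathcomp Require Import boolp classical_sets functions reals topology.
From mathcomp Require Import normedtype sequences.
From mathcomp Require Import ring.
Import Order.TTheory GRing.Theory Num.Theory.
Import numFieldNormedType.Exports.
Local Open Scope classical_set_scope.
Local Open Scope ring_scope.

(** Write h1, h2 for the poles, so that a = h1 h2 and c = - (h1 + h2), and
    order them so that |h1| = alpha <= |h2| = beta.  Everything follows from
    two factorizations, in which the only analytic input is that an ultrametric
    sum has the norm of its strictly dominant term:

      f(x) = x h1 h2 / ((x - h1) (x - h2)),
      f(x) - x2 = t (c t + (a - c^2)) / ((t + h1) (t + h2)),  t = x - x2.

    The second one uses f(x2) = x2 and x2 = h1 + h2.  Both denominators have norm
    |h1 h2| = |a| as soon as |x| < alpha, respectively |t| < alpha.  So f
    preserves |x| on the open ball U_alpha(0), while the sphere S_alpha(0)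
    contains the pole h1; this determines SI(0) ([SI_isometric]).

    Around x2 the multiplier is (a - c^2) / a, and the pole h2, at distance
    |h2 - x2| = |h1| = alpha, takes over the part of h1.  Let alpha = beta.  If
    |a - c^2| = alpha^2, which is automatic for |c| < alpha, then c t is dominated
    for |t| < alpha, so f preserves |t| there and [SI_isometric] applies again.  If
    |a - c^2| < alpha^2 = |c|^2, then for |t| < alpha the factor multiplying t has
    norm at most max(|t| / alpha, |a - c^2| / |a|) < 1, so the orbits in
    U_alpha(x2) converge geometrically to x2; for |t| >= alpha it is c t that
    dominates, and f keeps the point at distance at least alpha; this determines
    the basin
    ([basin_contraction]).  If alpha < beta, then |c| = beta, the numerator factor
    and one of the denominator factors have norms beta^2 and beta for all
    |t| < beta, and the remaining denominator factor is smaller than beta, which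
    makes f expand distances to x2. *)

(** * The p-adic norm *)

Section Norm.
Set Implicit Arguments.
Unset Strict Implicit.
Context {R : realType} {p : nat} {p_pr : prime p}.
Implicit Types (x y : Qp p_pr) (r : R).
Local Notation N := (Qp_norm R).

Lemma Qp_norm0 : N (0 : Qp p_pr) = 0.
Proof. by apply/eqP; rewrite Qp_norm_eq0. Qed.

Lemma Qp_norm_gt0 x : (0 < N x) = (x != 0).
Proof. by rewrite lt_def Qp_norm_ge0 andbT Qp_norm_eq0. Qed.

Lemma Qp_norm1 : N (1 : Qp p_pr) = 1.
Proof.
have n0 : N (1 : Qp p_pr) != 0 by rewrite Qp_norm_eq0 oner_eq0.
by apply: (mulfI n0); rewrite -Qp_normM !mulr1.
Qed.

Lemma Qp_normN x : N (- x) = N x.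
Proof. by rewrite /Qp_norm Qp_ratabsN. Qed.

Lemma Qp_normX x n : N (x ^+ n) = N x ^+ n.
Proof.
elim: n => [|n IH]; first by rewrite !expr0 Qp_norm1.
by rewrite !exprS Qp_normM IH.
Qed.

Lemma Qp_norm_div x y : N (x / y) = N x / N y.
Proof.
have [->|y0] := eqVneq y 0; first by rewrite invr0 Qp_norm0 invr0 !mulr0 Qp_norm0.
have Ny0 : N y != 0 by rewrite Qp_norm_eq0.
by apply: (mulIf Ny0); rewrite -Qp_normM !divfK.
Qed.

Lemma Qp_normD_le x y r : N x <= r -> N y <= r -> N (x + y) <= r.
Proof. by move=> xr yr; rewrite (le_trans (Qp_normD _ _ _)) // ge_max xr. Qed.

Lemma Qp_normD_lt x y r : N x < r -> N y < r -> N (x + y) < r.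
Proof. by move=> xr yr; rewrite (le_lt_trans (Qp_normD _ _ _)) // gt_max xr. Qed.

Lemma Qp_normB_le x y r : N x <= r -> N y <= r -> N (x - y) <= r.
Proof. by move=> xr yr; rewrite Qp_normD_le ?Qp_normN. Qed.

Lemma Qp_normB_lt x y r : N x < r -> N y < r -> N (x - y) < r.
Proof. by move=> xr yr; rewrite Qp_normD_lt ?Qp_normN. Qed.

(** If the sum were smaller than y, then y = (x + y) - x would be smaller than
    itself. *)
Lemma Qp_normD_dominant x y : N x < N y -> N (x + y) = N y.
Proof.
move=> xy; apply/eqP; rewrite eq_le Qp_normD_le ?(ltW xy) //=.
rewrite leNgt; apply/negP => lt_xy.
by have := Qp_normB_lt lt_xy xy; rewrite addrC addKr ltxx.
Qed.

Lemma Qp_two_neq0 : 2%:R != 0 :> Qp p_pr.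
Proof. by rewrite -(rmorph_nat (@Qp_of_rat p p_pr)) fmorph_eq0. Qed.

End Norm.

(** * Dynamics of partial maps around a point *)

Section PartialMaps.
Set Implicit Arguments.
Unset Strict Implicit.
Context {R : realType} {p : nat} {p_pr : prime p}.
Variables (g : Qp p_pr -> option (Qp p_pr)) (x0 : Qp p_pr).
Implicit Types (x y b l : Qp p_pr) (r B : R).
Local Notation N := (Qp_norm R).

(** An estimate of second order is how differentiability of a rational map
    arises: no limit has to be computed. *)
Lemma is_pderive_second_order l r B : g x0 = Some x0 -> 0 < r -> 0 <= B ->
  (forall x, N (x - x0) < r -> exists2 y, g x = Some y &
     N (y - x0 - l * (x - x0)) <= B * N (x - x0) ^+ 2) ->
  is_pderive R g x0 l.
Proof.
move=> gx0 r0 B0 hg; exists x0 => // e e0.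
(* B may vanish, whence the 1 added to it *)
have B1 : 0 < B + 1 by rewrite ltr_wpDl.
exists (Num.min r (e / (B + 1))); first by rewrite lt_min r0 divr_gt0.
move=> x xx0; rewrite lt_min => /andP[/hg[y gx hy] xe]; exists y => //.
have t0 : x - x0 != 0 by rewrite subr_eq0.
have Nt0 : 0 < N (x - x0) by rewrite Qp_norm_gt0.
have -> : (y - x0) / (x - x0) - l = (y - x0 - l * (x - x0)) / (x - x0).
  by rewrite [RHS]mulrBl mulfK.
rewrite Qp_norm_div ltr_pdivrMr // (le_lt_trans hy) // expr2 mulrA.
rewrite ltr_pM2r // mulrC; move: xe; rewrite ltr_pdivlMr //.
by apply: le_lt_trans; rewrite ler_pM2l // lerDl.
Qed.

Lemma invariant_sphere_step r :
  (forall x, Qp_sphere x0 r x -> exists2 y, g x = Some y & Qp_sphere x0 r y) ->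
  invariant_sphere g x0 r.
Proof.
move=> hg x xr n _; elim: n => [|n [y gy yr]]; first by exists x.
by have [z gz zr] := hg y yr; exists z => //; rewrite /piter iterS -/(piter g n x) gy.
Qed.

(** All spheres inside the ball are invariant, and the point b, where the map is
    not defined, prevents any larger ball from being a Siegel disk. *)
Lemma SI_isometric r b : 0 < r ->
  (forall x, N (x - x0) < r ->
     exists2 y, g x = Some y & N (y - x0) = N (x - x0)) ->
  N (b - x0) = r -> g b = None ->
  SI R g x0 = Qp_ball x0 r.
Proof.
move=> r0 hg br gb; apply/seteqP; split=> [x [r' [r'0 Sr']]|x xr]; last first.
  exists r => //; split=> // rho _ rho_r; apply: invariant_sphere_step => z zr.
  have zr' : N (z - x0) = rho by exact: zr.
  have [|y gz yz] := hg z; first by rewrite zr'.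
  by exists y => //; rewrite /Qp_sphere /= yz.
have [r'r|rr'] := leP r' r; first by rewrite /Qp_ball /= => /lt_le_trans; apply.
by have [y] := Sr' r r0 rr' b br 1%N isT; rewrite /piter /= gb.
Qed.

(** The factor max(|x - x0| / r, k) does not increase along an orbit, since the
    distance to x0 decreases; hence its value at the initial point is the ratio
    of a geometric sequence that bounds the whole orbit. *)
Lemma basin_contraction r k : 0 < r -> 0 <= k -> k < 1 ->
  (forall x, N (x - x0) < r -> exists2 y, g x = Some y &
     N (y - x0) <= Num.max (N (x - x0) / r) k * N (x - x0)) ->
  (forall x y, r <= N (x - x0) -> g x = Some y -> r <= N (y - x0)) ->
  basin R g x0 = Qp_ball x0 r.
Proof.
move=> r0 k0 k1 hin hout; apply/seteqP; split=> x.
  move=> [u [hu /cvgrPdist_lt /(_ r r0) [M _ hM]]].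
  rewrite /Qp_ball /= ltNge; apply/negP => xr.
  have far n : r <= N (u n.+1 - x0).
    elim: n => [|n IH]; first exact: hout xr (hu 1%N isT).
    apply: (hout _ _ IH); have := hu n.+2 isT.
    by rewrite /piter iterS -/(piter g n.+1 x) hu.
  have := hM M.+1 (leqnSn M); rewrite sub0r normrN ger0_norm ?Qp_norm_ge0 //.
  by rewrite ltNge far.
rewrite /Qp_ball /= => xr.
set q := Num.max (N (x - x0) / r) k.
have q0 : 0 <= q by rewrite le_max k0 orbT.
have q1 : q < 1 by rewrite gt_max k1 ltr_pdivrMr // mul1r xr.
have orbit n : exists2 y, piter g n x = Some y & N (y - x0) <= q ^+ n * N (x - x0).
  elim: n => [|n [y gy yn]]; first by exists x => //; rewrite expr0 mul1r.
  have yx : N (y - x0) <= N (x - x0).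
    by rewrite (le_trans yn) // ler_piMl ?Qp_norm_ge0 // exprn_ile1 // ltW.
  have [z gz zn] := hin y (le_lt_trans yx xr).
  exists z; first by rewrite /piter iterS -/(piter g n x) gy.
  rewrite (le_trans zn) // exprS -mulrA ler_pM ?Qp_norm_ge0 //.
    by rewrite le_max k0 orbT.
  rewrite ge_max !le_max lexx orbT andbT; apply/orP; left.
  by rewrite ler_pM2r ?invr_gt0.
exists (fun n => odflt 0 (piter g n x)); split=> [n _|].
  by have [y ->] := orbit n.
apply: (@squeeze_cvgr _ _ _ _ (fun=> 0) (fun n => q ^+ n * N (x - x0))).
- apply: nearW => n; have [y -> /= yn] := orbit n.
  by rewrite Qp_norm_ge0.
- exact: cvg_cst.
- rewrite -[X in _ --> X](mul0r (N (x - x0))); apply: cvgMl.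
  by apply: cvg_expr; rewrite ger0_norm.
Qed.

End PartialMaps.

(** * The rational map in terms of its poles *)

(** No norm enters these identities, and over an abstract field the arithmetic
    stays symbolic instead of unfolding the construction of the p-adic numbers from
    Cauchy sequences. *)
Section Identities.
Variable F : fieldType.
Implicit Types h x t a c s : F.

Lemma ratmap_sub_x2 h1 h2 x : x - h1 != 0 -> x - h2 != 0 ->
  let a := h1 * h2 in let c := - (h1 + h2) in let t := x + c in
  a * x / ((x - h1) * (x - h2)) + c =
  t * (c * t + (a - c ^+ 2)) / ((t + h1) * (t + h2)).
Proof.
move=> x1 x2 a c t.
have -> : t + h1 = x - h2 by rewrite /t /c; ring.
have -> : t + h2 = x - h1 by rewrite /t /c; ring.
by rewrite /t /c /a; field; rewrite x1 x2.
Qed.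

Lemma ratmap_second_order h1 h2 t : h1 != 0 -> h2 != 0 ->
    t + h1 != 0 -> t + h2 != 0 ->
  let a := h1 * h2 in let c := - (h1 + h2) in
  t * (c * t + (a - c ^+ 2)) / ((t + h1) * (t + h2)) - (a - c ^+ 2) / a * t =
  t ^+ 2 * (a * c - (a - c ^+ 2) * (t - c)) / (a * ((t + h1) * (t + h2))).
Proof.
by move=> h10 h20 d1 d2 a c; rewrite /a /c; field; rewrite h10 h20 d1 d2.
Qed.

Lemma Vieta_quadratic a c s : 2%:R != 0 :> F -> s ^+ 2 = c ^+ 2 - 4%:R * a ->
  let h1 := (- c + s) / 2%:R in let h2 := (- c - s) / 2%:R in
  a = h1 * h2 /\ c = - (h1 + h2).
Proof.
move=> two0 hs h1 h2; have four0 : 4%:R != 0 :> F by rewrite (natrM _ 2 2) mulf_neq0.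
split; last by rewrite /h1 /h2; field.
have -> : h1 * h2 = (c ^+ 2 - s ^+ 2) / 4%:R by rewrite /h1 /h2; field; rewrite four0 two0.
by rewrite hs opprB addrC subrK mulrC mulKf.
Qed.

End Identities.

Section Map.
Set Implicit Arguments.
Unset Strict Implicit.
Context {R : realType} {p : nat} {p_pr : prime p}.
Variables h1 h2 : Qp p_pr.
Hypotheses (h1_neq0 : h1 != 0) (h2_neq0 : h2 != 0).
Hypothesis h1_le_h2 : Qp_norm R h1 <= Qp_norm R h2.
Implicit Types x t : Qp p_pr.
Local Notation N := (Qp_norm R).
Let a : Qp p_pr := h1 * h2.
Let c : Qp p_pr := - (h1 + h2).
Let f := ratmap a c h1 h2.

Let a_neq0 : a != 0. Proof. exact: mulf_neq0. Qed.
Let Nh1_gt0 : 0 < N h1. Proof. by rewrite Qp_norm_gt0. Qed.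
Let Nh2_gt0 : 0 < N h2. Proof. by rewrite Qp_norm_gt0. Qed.
Let Nh12_gt0 : 0 < N h1 * N h2.
Proof. by rewrite pmulr_rgt0. Qed.
Let Na : N a = N h1 * N h2. Proof. exact: Qp_normM. Qed.
Let Nc_le : N c <= N h2.
Proof. by rewrite Qp_normN Qp_normD_le. Qed.

Lemma ratmap_factor x : x != h1 -> x != h2 ->
  f x = Some (a * x / ((x - h1) * (x - h2))).
Proof.
move=> /negPf x1 /negPf x2; rewrite /f /ratmap x1 x2 /=.
by congr (Some (_ / _)); rewrite /a /c; ring.
Qed.

Lemma ratmap_pole1 : f h1 = None.
Proof. by rewrite /f /ratmap eqxx. Qed.

Lemma ratmap_pole2 : f h2 = None.
Proof. by rewrite /f /ratmap eqxx orbT. Qed.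

Lemma ratmap_fixed_x2 : f (- c) = Some (- c).
Proof.
by apply/(ratmap_fixed_points a_neq0); [rewrite /c opprK|by []|right].
Qed.

(** The denominator is (x - h2) (x - h1), as x + c = x - h1 - h2. *)
Lemma ratmap_factor_x2 x : x != h1 -> x != h2 ->
  exists2 y, f x = Some y & y + c =
    (x + c) * (c * (x + c) + (a - c ^+ 2)) / ((x + c + h1) * (x + c + h2)).
Proof.
move=> x1 x2; exists (a * x / ((x - h1) * (x - h2))); first exact: ratmap_factor.
by apply: ratmap_sub_x2; rewrite subr_eq0.
Qed.

Let norm_shift t h : N h1 <= N h -> N t < N h1 -> N (t + h) = N h.
Proof. by move=> h1h th1; rewrite Qp_normD_dominant // (lt_le_trans th1). Qed.

Lemma SI_zero : SI R f 0 = Qp_ball 0 (N h1).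
Proof.
apply: (@SI_isometric _ _ _ _ _ _ h1) => //; last exact: ratmap_pole1.
  move=> x; rewrite subr0 => xh1.
  have D1 : N (x - h1) = N h1 by rewrite norm_shift ?Qp_normN.
  have D2 : N (x - h2) = N h2 by rewrite norm_shift ?Qp_normN.
  have D1' : x - h1 != 0 by rewrite -(Qp_norm_gt0 (R := R)) D1.
  have D2' : x - h2 != 0 by rewrite -(Qp_norm_gt0 (R := R)) D2.
  eexists; first by apply: ratmap_factor; rewrite -subr_eq0.
  rewrite subr0 Qp_norm_div !Qp_normM D1 D2 mulrAC divff ?mul1r //.
  by rewrite lt0r_neq0.
by rewrite subr0.
Qed.

(** The ball of radius alpha around x2 contains no pole. *)
Let near_x2 x : N (x + c) < N h1 -> exists2 y, f x = Some y & y + c =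
    (x + c) * (c * (x + c) + (a - c ^+ 2)) / ((x + c + h1) * (x + c + h2)).
Proof.
move=> xh1; apply: ratmap_factor_x2; apply: contraTneq xh1 => ->.
  by rewrite /c opprD addNKr Qp_normN -leNgt.
by rewrite /c opprD addrCA subrr addr0 Qp_normN ltxx.
Qed.

Let norm_denom t : N t < N h1 -> N ((t + h1) * (t + h2)) = N a.
Proof. by move=> th1; rewrite Qp_normM !norm_shift. Qed.

Lemma ratmap_deriv_x2 : is_pderive R f (- c) ((a - c ^+ 2) / a).
Proof.
apply: (@is_pderive_second_order _ _ _ _ _ _ (N h1)
          (N h2 ^+ 3 / N a ^+ 2)) => //.
- exact: ratmap_fixed_x2.
- by rewrite divr_ge0 ?exprn_ge0 ?Qp_norm_ge0.
move=> x; rewrite !opprK => xh1; have [y fx yE] := near_x2 xh1.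
exists y; rewrite // yE; move: xh1; set t := x + c => th1.
have Nd := norm_denom th1.
have : (t + h1) * (t + h2) != 0 by rewrite -(Qp_norm_gt0 (R := R)) Nd Qp_norm_gt0.
rewrite mulf_eq0 => /norP[d1 d2].
rewrite ratmap_second_order //.
rewrite Qp_norm_div [N (_ * (_ - _))]Qp_normM Qp_normX [N (a * _)]Qp_normM Nd.
rewrite -expr2 -mulrA [leRHS]mulrC ler_wpM2l ?exprn_ge0 ?Qp_norm_ge0 //.
rewrite ler_wpM2r ?invr_ge0 ?exprn_ge0 ?Qp_norm_ge0 //.
have Na2 : N a <= N h2 ^+ 2 by rewrite Na expr2 ler_pM2r.
have tc : N (t - c) <= N h2.
  by rewrite Qp_normB_le // (le_trans (ltW th1)).
have c2 : N (c ^+ 2) <= N h2 ^+ 2.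
  by rewrite Qp_normX ler_pXn2r ?nnegrE ?Qp_norm_ge0.
have ac2 : N (a - c ^+ 2) <= N h2 ^+ 2 by exact: Qp_normB_le.
by apply: Qp_normB_le; rewrite Qp_normM [leRHS]exprSr ler_pM ?Qp_norm_ge0.
Qed.

(** Cancelling |t| |a| shows that f is an isometry towards x2 where a - c^2 has
    the norm of a and dominates c t. *)
Lemma x2_indifferent : N h1 = N h2 -> N (a - c ^+ 2) = N h1 ^+ 2 ->
  indifferent R f (- c) /\ SI R f (- c) = Qp_ball (- c) (N h1).
Proof.
move=> h12 Nd; have Na2 : N a = N h1 ^+ 2 by rewrite Na -h12 expr2.
have Nh1sq : N h1 ^+ 2 != 0 by rewrite expf_neq0 // lt0r_neq0.
split.
  split; first exact: ratmap_fixed_x2.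
  exists ((a - c ^+ 2) / a); first exact: ratmap_deriv_x2.
  by rewrite Qp_norm_div Nd Na2 divff.
apply: (@SI_isometric _ _ _ _ _ _ h2) => //; last exact: ratmap_pole2.
- move=> x; rewrite opprK => xh1; have [y fx yE] := near_x2 xh1.
  exists y; rewrite // yE Qp_norm_div (norm_denom xh1) Qp_normM.
  rewrite [N (c * _ + _)]Qp_normD_dominant; first by rewrite Nd Na2 mulfK.
  rewrite Nd Qp_normM expr2 (le_lt_trans (_ : _ <= N h1 * N (x + c))) //.
    by rewrite ler_wpM2r ?Qp_norm_ge0 // h12.
  by rewrite ltr_pM2l.
- by rewrite opprK /c opprD addrCA subrr addr0 Qp_normN.
Qed.

(** For |t| >= alpha the image is at distance at least
    |t| |c t| / |t|^2 = |c| = alpha from x2, which is why the condition on |c| makes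
    the basin end at this sphere. *)
Lemma x2_attractive : N c = N h1 -> N h1 = N h2 -> N (a - c ^+ 2) < N h1 ^+ 2 ->
  attractive R f (- c) /\ basin R f (- c) = Qp_ball (- c) (N h1).
Proof.
move=> Nc h12 Nd; have Na2 : N a = N h1 ^+ 2 by rewrite Na -h12 expr2.
have Nh1sq : 0 < N h1 ^+ 2 by rewrite exprn_gt0.
have lam1 : N (a - c ^+ 2) / N a < 1 by rewrite Na2 ltr_pdivrMr // mul1r.
split.
  split; first exact: ratmap_fixed_x2.
  exists ((a - c ^+ 2) / a); first exact: ratmap_deriv_x2.
  by rewrite Qp_norm_div.
apply: (@basin_contraction _ _ _ _ _ _ (N (a - c ^+ 2) / N a)) => //.
- by rewrite divr_ge0 ?Qp_norm_ge0.
- move=> x; rewrite opprK => xh1; have [y fx yE] := near_x2 xh1.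
  exists y; rewrite // yE Qp_norm_div (norm_denom xh1) Qp_normM.
  rewrite -mulrA mulrC ler_wpM2r ?Qp_norm_ge0 //.
  rewrite ler_pdivrMr ?Qp_norm_gt0 // (le_trans (Qp_normD _ _ _)) //.
  rewrite ge_max; apply/andP; split.
    rewrite Qp_normM Nc Na2 (le_trans (_ : _ <= N (x + c) / N h1 * N h1 ^+ 2)) //.
      by rewrite expr2 mulrA divfK ?lt0r_neq0 // mulrC.
    by rewrite ler_pM2r // le_max lexx.
  rewrite -[leLHS](divfK (_ : N a != 0)) ?Na2 ?lt0r_neq0 // ler_pM2r //.
  by rewrite le_max lexx orbT.
- move=> x y; rewrite !opprK => xh1 fx.
  have xn1 : x != h1 by apply: contra_eq_neq fx => ->; rewrite ratmap_pole1.
  have xn2 : x != h2 by apply: contra_eq_neq fx => ->; rewrite ratmap_pole2.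
  have [y'] := ratmap_factor_x2 xn1 xn2; rewrite fx => -[<-] ->.
  have : (x + c + h1) * (x + c + h2) != 0.
    have -> : (x + c + h1) * (x + c + h2) = (x - h2) * (x - h1) by rewrite /c; ring.
    by apply: mulf_neq0; rewrite subr_eq0.
  move: xh1; set t := x + c => th1 d0.
  have Nt0 : 0 < N t by exact: lt_le_trans th1.
  have Nct : N (c * t) = N h1 * N t by rewrite Qp_normM Nc.
  have dom : N (a - c ^+ 2) < N (c * t).
    by rewrite Nct (lt_le_trans Nd) // expr2 ler_pM2l.
  rewrite Qp_norm_div Qp_normM [c * t + _]addrC [N (_ + c * t)]Qp_normD_dominant // Nct.
  rewrite ler_pdivlMr ?Qp_norm_gt0 // [leRHS]mulrCA ler_pM2l // Qp_normM.
  by rewrite ler_pM ?Qp_norm_ge0 // Qp_normD_le // -h12.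
Qed.

(** The larger pole dominates in c = - (h1 + h2), hence c^2 in a - c^2.  The poles
    lie at distances alpha and beta from x2, so for |x - x2| < beta only the distance
    from x to the nearer one can vary, and it stays below beta. *)
Lemma x2_repelling : N h1 < N h2 ->
  [/\ N c = N h2, repelling R f (- c) &
      forall x, N (x + c) < N h2 -> x != - c -> x != h1 -> x != h2 ->
        exists2 y, f x = Some y & N (x + c) < N (y + c)].
Proof.
move=> h12; have Nc : N c = N h2 by rewrite Qp_normN Qp_normD_dominant.
have Nd : N (a - c ^+ 2) = N h2 ^+ 2.
  by rewrite Qp_normD_dominant Qp_normN Qp_normX Nc // Na expr2 ltr_pM2r.
split=> //.
  split; first exact: ratmap_fixed_x2.
  exists ((a - c ^+ 2) / a); first exact: ratmap_deriv_x2.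
  rewrite Qp_norm_div Nd Na expr2 ltr_pdivlMr // mul1r.
  by rewrite ltr_pM2r.
move=> x xh2 xc x1 x2; have [y fx yE] := ratmap_factor_x2 x1 x2.
exists y; rewrite // yE.
have : x + c + h1 != 0.
  by have -> : x + c + h1 = x - h2 by [rewrite /c; ring]; rewrite subr_eq0.
have : x + c != 0 by rewrite addr_eq0.
move: xh2; set t := x + c => th2 t0 d0.
have D2 : N (t + h2) = N h2 by rewrite Qp_normD_dominant.
have Nct : N (c * t) < N (a - c ^+ 2).
  by rewrite Qp_normM Nd Nc expr2 ltr_pM2l.
rewrite Qp_norm_div Qp_normM [N (c * _ + _)]Qp_normD_dominant // Nd [N (_ * (t + h2))]Qp_normM D2.
have den0 : 0 < N (t + h1) * N h2 by rewrite pmulr_lgt0 ?Qp_norm_gt0.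
rewrite ltr_pdivlMr // ltr_pM2l ?Qp_norm_gt0 //.
by rewrite expr2 ltr_pM2r // Qp_normD_lt.
Qed.

End Map.

Lemma ratmapC p (p_pr : prime p) (a c h1 h2 : Qp p_pr) :
  ratmap a c h1 h2 = ratmap a c h2 h1.
Proof. by apply/funext => x; rewrite /ratmap orbC. Qed.

(** An ultrametric triangle is isosceles: its side from z to x is the short one. *)
Lemma Qp_ball_sub_sphere {R : realType} {p : nat} {p_pr : prime p}
    (x y : Qp p_pr) (r : R) :
  Qp_norm R (x - y) = r -> Qp_ball x r `<=` Qp_sphere y r.
Proof.
move=> xy z zr; rewrite /Qp_sphere /= -(subrK x z) -addrA.
by rewrite Qp_normD_dominant xy.
Qed.

Lemma Qp_ball_recenter {R : realType} {p : nat} {p_pr : prime p}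
    (x y : Qp p_pr) (r : R) :
  Qp_norm R (x - y) < r -> Qp_ball x r = Qp_ball y r.
Proof.
move=> xy; apply/seteqP; split=> z zr; rewrite /Qp_ball /=.
  by rewrite -(subrK x z) -addrA Qp_normD_lt.
by rewrite -(subrK y z) -addrA Qp_normD_lt // -opprB Qp_normN.
Qed.

Theorem theorem1 (R : realType) (p : nat) (p_pr : prime p)
    (a c s : Qp p_pr) (hac : a * c != 0) (hs : s ^+ 2 = c ^+ 2 - 4%:R * a) :
  let xh1 : Qp p_pr := (- c + s) / 2%:R in
  let xh2 : Qp p_pr := (- c - s) / 2%:R in
  let f := ratmap a c xh1 xh2 in
  let x1 : Qp p_pr := 0 in
  let x2 : Qp p_pr := - c in
  let alpha := Num.min (Qp_norm R xh1) (Qp_norm R xh2) in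
  let beta := Num.max (Qp_norm R xh1) (Qp_norm R xh2) in
  (SI R f x1 = Qp_ball 0 alpha) /\
  (Qp_norm R c < alpha -> alpha = beta ->
     indifferent R f x2 /\ SI R f x2 = SI R f x1) /\
  (Qp_norm R c = alpha -> alpha = beta ->
     Qp_norm R (a - c ^+ 2) = alpha ^+ 2 ->
     [/\ indifferent R f x2, SI R f x2 = Qp_ball x2 alpha
       & SI R f x2 `&` SI R f x1 = set0]) /\
  (Qp_norm R c = alpha -> alpha = beta ->
     Qp_norm R (a - c ^+ 2) < alpha ^+ 2 ->
     [/\ attractive R f x2, basin R f x2 = Qp_ball x2 alpha
       & Qp_ball x2 alpha `<=` Qp_sphere 0 alpha]) /\
  (alpha < beta ->
     [/\ Qp_sphere 0 beta x2, repelling R f x2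
       & forall x, Qp_ball x2 beta x -> x != x2 -> x != xh1 -> x != xh2 ->
           exists2 y, f x = Some y & Qp_norm R (x - x2) < Qp_norm R (y - x2)]).
Proof.
have two0 : 2%:R != 0 :> Qp p_pr := Qp_two_neq0.
move: hac; rewrite mulf_eq0 => /norP[a0 _] xh1 xh2.
have [Ea Ec] : a = xh1 * xh2 /\ c = - (xh1 + xh2) by exact: Vieta_quadratic.
clearbody xh1 xh2; clear s hs; subst a c.
move: a0; rewrite mulf_eq0 => /norP[h1_neq0 h2_neq0].
(* the statement is symmetric in the poles *)
wlog h12 : xh1 xh2 h1_neq0 h2_neq0 / Qp_norm R xh1 <= Qp_norm R xh2.
  move=> W; have /orP[|h21] := le_total (Qp_norm R xh1) (Qp_norm R xh2); first exact: W.
  move: (W _ _ h2_neq0 h1_neq0 h21); cbv zeta.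
  rewrite [xh2 * xh1]mulrC [xh2 + xh1]addrC (ratmapC _ _ xh2 xh1) minC maxC.
  move=> [W1 [W2 [W3 [W4 W5]]]]; do 4 split=> //.
  by move=> /W5[W51 W52 W53]; split=> // x xb xn x1 x2; exact: W53.
rewrite (min_idPl h12) (max_idPr h12) => f x1 x2 alpha beta.
have SI1 : SI R f x1 = Qp_ball 0 alpha by exact: SI_zero.
have Nx2 : Qp_norm R (x2 - 0) = Qp_norm R (- (xh1 + xh2)).
  by rewrite subr0 [LHS]Qp_normN.
split=> //; split; [|split; [|split]].
- move=> cl ab.
  have Nd : Qp_norm R (xh1 * xh2 - (- (xh1 + xh2)) ^+ 2) = alpha ^+ 2.
    have Na : Qp_norm R (xh1 * xh2) = alpha ^+ 2 by rewrite Qp_normM expr2 {2}ab.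
    rewrite addrC Qp_normD_dominant // Qp_normN Na Qp_normX.
    by rewrite ltrXn2r ?Qp_norm_ge0.
  have [ind ->] := x2_indifferent h1_neq0 h2_neq0 h12 ab Nd.
  by split=> //; rewrite SI1; apply: Qp_ball_recenter; rewrite Nx2.
- move=> cl ab Nd.
  have [ind SI2] := x2_indifferent h1_neq0 h2_neq0 h12 ab Nd.
  split=> //; rewrite SI1 [SI _ _ _]SI2; apply/seteqP; split=> // z [zx2 z0].
  have zs : Qp_norm R (z - 0) = alpha.
    by apply: (Qp_ball_sub_sphere _ zx2); rewrite Nx2.
  by move: z0; rewrite /Qp_ball /= zs ltxx.
- move=> cl ab Nd.
  have [att bas] := x2_attractive h1_neq0 h2_neq0 h12 cl ab Nd.
  by split=> //; apply: Qp_ball_sub_sphere; rewrite Nx2.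
- move=> ab; have [Nc rep ex] := x2_repelling h1_neq0 h2_neq0 h12 ab.
  split=> //; first by rewrite /Qp_sphere /= Nx2.
  move=> x; rewrite /Qp_ball /= opprK => xb xn xn1 xn2.
  by have [y fx yx] := ex x xb xn xn1 xn2; exists y; rewrite // opprK.
Qed.
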